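(* Let $n\geq2$ be an integer, $G$ the symmetric group $\mathfrak{S}_n$ and $H=\mathfrak{S}_{n-1}=(\mathfrak{S}_n)_1$ the stabilizer of $1$ in $G$. Let $\rho\colon G\to GL(W)$ be the subrepresentation of the natural (permutation) representation $G\to GL(n,\mathbb{R})$ on $W=\{(x_1,\dots,x_n)\in\mathbb{R}^n\mid\sum_{i=1}^nx_i=0\}$. Then $v_0:=(-(n-1),1,\dots,1)\in W$ is $H$-fixed, and the family $\mathcal{P}$ obtained from $(G,H,W,v_0)$ by the method described in the context, under the identification $G/H\simeq\{1,\dots,n\}$, $\sigma H\mapsto\sigma(1)$, is the family of categorical distributions on $\{1,\dots,n\}$, $$\left\{s_1^{\delta_{1,x}}s_2^{\delta_{2,x}}\cdots s_n^{\delta_{n,x}}\,dc(x)\right\}_{(s_1,\dots,s_n)},\qquad x\in\{1,2,\dots,n\},$$ where $(s_1,\dots,s_n)$ ranges over all $n$-tuples of real numbers with $s_i>0$ for all $i$ and $\sum_{i=1}^ns_i=1$, $dc$ denotes the counting measure on $\{1,\dots,n\}$, and $\delta_{i,x}$ is the Kronecker delta.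
   Context: The natural representation of $\mathfrak{S}_n$ on $\mathbb{R}^n$ permutes the standard basis: $\sigma e_i=e_{\sigma(i)}$. The method: let $G$ be a Lie group with finitely many connected components, $H$ a closed subgroup, $X:=G/H$, $\rho\colon G\to GL(V)$ a continuous finite dimensional real representation and $v_0\in V$ an $H$-fixed vector. Put $W_0(G,H):=\{\tau\colon G\to\mathbb{R}\mid\tau\text{ is a continuous group homomorphism with }\tau|_H=0\}$. Take a nonzero relatively $G$-invariant Radon measure $\nu$ on $X$ (i.e. for some $\chi\colon G\to\mathbb{R}_{>0}$ the pushforward satisfies $g\cdot\nu=\chi(g)^{-1}\nu$ for all $g\in G$), assumed to exist; the resulting family does not depend on the choice of $\nu$. For $\theta=(\varphi,\tau)\in V^\vee\times W_0(G,H)$ and $x=gH$, put $\rho(x)v_0:=\rho(g)v_0$, $\tau(x):=\tau(g)$ and $d\tilde p_\theta(x):=\exp(-\langle\varphi,\rho(x)v_0\rangle+\tau(x))\,d\nu(x)$. Let $\Theta:=\{\theta\in V^\vee\times W_0(G,H)\mid\int_Xd\tilde p_\theta<\infty\}$ and, for $\theta\in\Theta$, $p_\theta:=(\int_Xd\tilde p_\theta)^{-1}\tilde p_\theta$. The family obtained is the set $\mathcal{P}:=\{p_\theta\}_{\theta\in\Theta}$ of probability measures on $X$. *)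

(* Defs.v *)
From HB Require Import structures.
From mathcomp Require Import all_boot all_order all_fingroup all_algebra.
From mathcomp Require Import generic_quotient.
From mathcomp Require Import all_classical all_reals all_analysis.

Set Implicit Arguments.
Unset Strict Implicit.
Unset Printing Implicit Defensive.

Import Order.TTheory GRing.Theory Num.Theory.
Import numFieldNormedType.Exports.

Local Open Scope classical_set_scope.
Local Open Scope ring_scope.
Local Open Scope quotient_scope.

(* The family attached to (G, H, V, rho, v0) only uses the topological group
   underlying a Lie group, so it is defined for topological groups. *)
HB.mixin Record isTopologicalGroup G of Topological G & monoid.Group G := {
  mulg_continuous : continuous (fun x : G * G => (x.1 * x.2)%g);
  invg_continuous : continuous (fun x : G => x^-1%g)
}.

#[short(type="topologicalGroupType")]
HB.structure Definition TopologicalGroup :=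
  {G of Topological G & monoid.Group G & isTopologicalGroup G}.

Section CosetSpace.
Variables (G : topologicalGroupType) (H : groupClosed G).

Definition same_coset (g h : G) : bool := (g^-1 * h)%g \in H.

Lemma same_coset_refl : reflexive same_coset.
Proof. by move=> g; rewrite /same_coset mulVg gpred1. Qed.

Lemma same_coset_sym : symmetric same_coset.
Proof. by move=> g h; rewrite /same_coset -gpredV invgM invgK. Qed.

Lemma same_coset_trans : transitive same_coset.
Proof.
move=> h g k; rewrite /same_coset => gh hk.
by rewrite -[k](mulKVg h) mulgA gpredM.
Qed.

Canonical same_coset_equiv :=
  EquivRel same_coset same_coset_refl same_coset_sym same_coset_trans.

(* G / H, the space of cosets gH, with the quotient topology. *)
Definition coset_space : Type :=
  quotient_topology {eq_quot same_coset_equiv}.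

HB.instance Definition _ := Topological.on coset_space.
HB.instance Definition _ := Quotient.on coset_space.
HB.instance Definition _ :=
  isPointed.Build coset_space (\pi_coset_space (1%g : G)).

Definition translate (g : G) (x : coset_space) : coset_space :=
  \pi_coset_space (g * repr x)%g.

Definition borel_coset_space := g_sigma_algebraType (@open coset_space).

HB.instance Definition _ := Measurable.on borel_coset_space.

End CosetSpace.

Section Method.
Variables (R : realType) (G : topologicalGroupType) (H : groupClosed G).
Variables (V : vectType R).
Local Notation X := (borel_coset_space H).

Definition continuous_representation (rho : G -> 'End(V)) : Prop :=
  [/\ rho 1%g = \1%VF,
      forall g h, rho (g * h)%g = (rho g \o rho h)%VF &
      continuous (fun g => passmx.mxof (vbasis {:V}) (vbasis {:V}) (rho g))].

Definition admissible (rho : G -> 'End(V)) (v0 : V) : Prop :=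
  [/\ closed [set h : G | h \in H],
      continuous_representation rho &
      {in H, forall h, rho h v0 = v0}].

Definition radon (nu : {measure set X -> \bar R}) : Prop :=
  [/\ forall K : set (coset_space H), compact K -> (nu K < +oo)%E,
      forall A : set X, measurable A ->
        nu A = ereal_inf
          [set nu U | U in [set U : set (coset_space H) | open U /\ A `<=` U]] &
      forall U : set (coset_space H), open U ->
        nu U = ereal_sup
          [set nu K | K in [set K : set (coset_space H) |
                              compact K /\ K `<=` U]]].

Definition relatively_invariant (nu : {measure set X -> \bar R}) : Prop :=
  exists2 chi : G -> R, (forall g, 0 < chi g) &
    forall (g : G) (A : set X), measurable A ->
      pushforward nu (translate g : X -> X) A = (((chi g)^-1)%:E * nu A)%E.

Definition reference_measure (nu : {measure set X -> \bar R}) : Prop :=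
  [/\ radon nu, relatively_invariant nu & nu [set: X] <> 0%E].

Definition W0 : set (G -> R) :=
  [set tau | [/\ continuous tau,
                 {morph tau : g h / (g * h)%g >-> g + h} &
                 {in H, forall h, tau h = 0}]].

Section Family.
Variables (rho : G -> 'End(V)) (v0 : V) (nu : {measure set X -> \bar R}).

(* V^\vee x W0, the second component being restricted to W0 in param_set. *)
Definition param : Type := ('Hom(V, R^o) * (G -> R))%type.

(* [repr x] is some g with x = gH; the value does not depend on it when v0 is
   H-fixed and theta.2 is in W0. *)
Definition density (theta : param) (x : X) : R :=
  let g : G := repr (x : coset_space H) in
  expR (- (theta.1 (rho g v0) : R) + theta.2 g).

Definition tilde_p (theta : param) (A : set X) : \bar R :=
  (\int[nu]_(x in A) (density theta x)%:E)%E.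

Definition param_set : set param :=
  [set theta | W0 theta.2 /\ (tilde_p theta [set: X] < +oo)%E].

(* Measures are only compared on measurable sets: the library's set functions
   carry junk values elsewhere. *)
Definition exp_family : set (probability X R) :=
  [set P | exists2 theta, param_set theta &
     forall A, measurable A ->
       P A = (((fine (tilde_p theta [set: X]))^-1)%:E * tilde_p theta A)%E].

End Family.
End Method.

Definition transported_family (R : realType) d1 d2 (T1 : measurableType d1)
    (T2 : measurableType d2) (f : T1 -> T2) (F : set (probability T1 R)) :
    set (probability T2 R) :=
  [set Q | exists2 P, F P &
     forall A, measurable A -> Q A = pushforward P f A].

(* The symmetric group. The product of {perm 'I_n} is (s * t) i = t (s i), so it
   is reversed here to get the usual composition, (s * t) i = s (t i); this is
   what makes s H a left coset and the permutation representation a left one. *)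
Section SymmetricGroup.
Variable n : nat.

Definition sym : Type := {perm 'I_n}.
Definition sym_perm (s : sym) : {perm 'I_n} := s.
Definition sym_mul (s t : sym) : sym := (sym_perm t * sym_perm s)%g.
Definition sym_inv (s : sym) : sym := (sym_perm s)^-1%g.
Definition sym_one : sym := 1%g : {perm 'I_n}.

HB.instance Definition _ :=
  DiscreteTopology.copy sym (discrete_topology {perm 'I_n}).

Lemma sym_mulA : associative sym_mul.
Proof. by move=> s t u; rewrite /sym_mul /sym_perm mulgA. Qed.
Lemma sym_mul1 : left_id sym_one sym_mul.
Proof. by move=> s; rewrite /sym_mul /sym_one /sym_perm mulg1. Qed.
Lemma sym_mulr1 : right_id sym_one sym_mul.
Proof. by move=> s; rewrite /sym_mul /sym_one /sym_perm mul1g. Qed.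
Lemma sym_mulV : left_inverse sym_one sym_inv sym_mul.
Proof. by move=> s; rewrite /sym_mul /sym_inv /sym_one /sym_perm mulgV. Qed.
Lemma sym_mulrV : right_inverse sym_one sym_inv sym_mul.
Proof. by move=> s; rewrite /sym_mul /sym_inv /sym_one /sym_perm mulVg. Qed.

HB.instance Definition _ :=
  isGroup.Build sym sym_mulA sym_mul1 sym_mulr1 sym_mulV sym_mulrV.

Lemma sym_mulE (s t : sym) (i : 'I_n) :
  sym_perm (s * t)%g i = sym_perm s (sym_perm t i).
Proof. exact: permM. Qed.

Lemma sym_mul_continuous : continuous (fun x : sym * sym => (x.1 * x.2)%g).
Proof.
move=> [s t] A /nbhs_singleton /= Ast.
exists ([set s], [set t]); first by split; exact: discrete_set1.
by move=> [u v] /= [-> ->].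
Qed.

Lemma sym_inv_continuous : continuous (fun x : sym => x^-1%g).
Proof.
move=> s A /nbhs_singleton As.
by apply: (@filterS _ (nbhs s) _ [set s]); [move=> _ ->|exact: discrete_set1].
Qed.

HB.instance Definition _ :=
  isTopologicalGroup.Build sym sym_mul_continuous sym_inv_continuous.

End SymmetricGroup.

Section Stabilizer.
Variables (n : nat) (i : 'I_n).

Definition stabilizer : {pred sym n} := [pred s | sym_perm s i == i].

Lemma stabilizer1 : (1%g : sym n) \in stabilizer.
Proof. by rewrite inE; apply/eqP; exact: perm1. Qed.

Lemma stabilizerM : mulg_closed stabilizer.
Proof.
by move=> s t; rewrite !inE => /eqP si /eqP ti; rewrite sym_mulE ti si.
Qed.

Lemma stabilizerV : invg_closed stabilizer.
Proof.
move=> s; rewrite !inE => /eqP si; apply/eqP.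
by rewrite -{1}si; exact: permK.
Qed.

HB.instance Definition _ := isMulClosed.Build (sym n) stabilizer stabilizerM.
HB.instance Definition _ := isMul1Closed.Build (sym n) stabilizer stabilizer1.
HB.instance Definition _ := isInvClosed.Build (sym n) stabilizer stabilizerV.

End Stabilizer.

Section PermutationRepresentation.
Variables (R : realType) (n : nat).

Definition perm_rep (s : sym n) : 'End('rV[R]_n) :=
  linfun (mulmxr (perm_mx (sym_perm s))).

Lemma perm_rep_delta (s : sym n) (i : 'I_n) :
  perm_rep s (delta_mx 0 i) = delta_mx 0 (sym_perm s i).
Proof.
rewrite lfunE /= -rowE; apply/rowP => j.
by rewrite !mxE eqxx /= eq_sym.
Qed.

Definition sum_zero : {vspace 'rV[R]_n} :=
  lker (linfun (mulmxr (const_mx 1 : 'cV[R]_n))).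

Lemma mem_sum_zero (x : 'rV[R]_n) :
  (x \in sum_zero) = (\sum_(i < n) x 0 i == 0).
Proof.
rewrite memv_ker lfunE /= /mulmxr.
have sumE i j : (x *m (const_mx 1 : 'cV[R]_n)) i j = \sum_(k < n) x 0 k.
  by rewrite !ord1 !mxE; apply: eq_bigr => k _; rewrite mxE mulr1.
apply/eqP/eqP => [/matrixP/(_ 0 0)|sx]; first by rewrite sumE mxE.
by apply/matrixP => i j; rewrite sumE sx mxE.
Qed.

Lemma perm_rep_sum_zero (s : sym n) (x : 'rV[R]_n) :
  x \in sum_zero -> perm_rep s x \in sum_zero.
Proof.
rewrite !mem_sum_zero => /eqP sx; apply/eqP; rewrite -[RHS]sx lfunE /=.
rewrite -[sym_perm s]invgK -col_permE.
rewrite (reindex_inj (@perm_inj _ (sym_perm s))).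
by apply: eq_bigr => i _; rewrite mxE permK.
Qed.

(* The restriction of perm_rep to sum_zero; vsproj only retypes, see
   standard_repE. *)
Definition standard_rep (s : sym n) : 'End(subvs_of sum_zero) :=
  linfun (vsproj sum_zero \o perm_rep s \o vsval).

Lemma standard_repE (s : sym n) (w : subvs_of sum_zero) :
  vsval (standard_rep s w) = perm_rep s (vsval w).
Proof. by rewrite lfunE /= vsprojK // perm_rep_sum_zero // subvsP. Qed.

End PermutationRepresentation.

Section Categorical.
Variables (R : realType) (n : nat) (hn : (2 <= n)%N).

(* The point "1" of {1, ..., n}. *)
Definition first : 'I_n := Ordinal (ltnW hn).

(* {1, ..., n} as a discrete measurable space; the bound hn is there because
   measurable types have to be inhabited. *)
Definition outcomes of (2 <= n)%N : Type := 'I_n.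

HB.instance Definition _ := Choice.copy (outcomes hn) 'I_n.
HB.instance Definition _ := isPointed.Build (outcomes hn) first.
HB.instance Definition _ := @isMeasurable.Build default_measure_display
  (outcomes hn) discrete_measurable discrete_measurable0
  discrete_measurableC discrete_measurableU.

Definition base_vector : 'rV[R]_n :=
  \row_(i < n) (if i == first then - (n%:R - 1) else 1).

Definition orbit_point (x : borel_coset_space (stabilizer first)) :
    outcomes hn :=
  sym_perm (repr (x : coset_space (stabilizer first))) first.

Definition categorical : set (probability (outcomes hn) R) :=
  [set P | exists s : 'I_n -> R,
     [/\ forall i, 0 < s i, \sum_(i < n) s i = 1 &
         forall A, measurable A ->
           P A = (\int[@counting (outcomes hn) R]_(x in A)
                    (\prod_(i < n) s i ^+ (i == x))%:E)%E]].

End Categorical.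

Arguments base_vector R {n} hn.
Arguments orbit_point {n} hn x.
Arguments categorical R {n} hn.

(* Main.v *)
(* G = S_n is finite and discrete, so G/H is a discrete space with n points. A
   reference measure gives each point a positive finite mass, by transitivity of
   G, hence every member of the family has full support. Conversely, the orbit
   vectors (1, ..., 1) - n e_i, i = 1, ..., n, are affinely independent, so the
   pairing with a suitable phi takes any prescribed values on them up to an
   additive constant, which normalization absorbs. With tau = 0 this reaches
   every probability of full support. *)
Require Import Defs.
From HB Require Import structures.
From mathcomp Require Import all_boot all_order all_fingroup all_algebra.
From mathcomp Require Import generic_quotient finmap.
From mathcomp Require Import all_classical all_reals all_analysis.

Set Implicit Arguments.
Unset Strict Implicit.
Unset Printing Implicit Defensive.

Import Order.TTheory GRing.Theory Num.Theory.
Import numFieldNormedType.Exports.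

Local Open Scope classical_set_scope.
Local Open Scope ring_scope.
Local Open Scope quotient_scope.

(** * Integration on a finite discrete measurable space *)

Section FiniteDiscreteMeasure.
Context d (T : measurableType d) (R : realType) (I : finType) (e : I -> T).
Variable mu : {measure set T -> \bar R}.
Hypothesis e_bij : bijective e.
Hypothesis T_discrete : forall A : set T, measurable A.

Lemma ge0_integral_discrete (f : T -> R) (A : set T) : (forall x, 0 <= f x) ->
  (\int[mu]_(x in A) (f x)%:E =
   \sum_(i | e i \in A) (f (e i))%:E * mu [set e i])%E.
Proof.
move=> f0; have e_inj := bij_inj e_bij.
(* Surjectivity of [e] makes the singletons [[set e i]] cover [A], injectivity makes them disjoint,
   and the integrand is constant on each. *)
have -> : A = \big[setU/set0]_(i <- [seq i <- index_enum I | e i \in A])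
                [set e i].
  rewrite -bigcup_seq; apply/seteqP; split=> [x Ax|x [i] /=]; last first.
    by rewrite mem_filter => /andP[+ _] ->; rewrite inE.
  have [g _ gK] := e_bij; exists (g x); last by rewrite /= gK.
  by rewrite /= mem_filter gK mem_index_enum andbT inE.
rewrite ge0_integral_bigsetU //; last first.
- by move=> x _; rewrite lee_fin.
- by move=> i j _ _ [x [/= -> /e_inj]].
- by rewrite filter_uniq // index_enum_uniq.
rewrite -bigcup_seq big_filter.
apply: eq_big => [i|i _].
  apply/idP/idP => [ei|]; rewrite inE.
    by exists i => //=; rewrite mem_filter ei mem_index_enum.
  by move=> [j /=]; rewrite mem_filter => /andP[+ _] /e_inj ->.
by rewrite -integral_cst //; apply: eq_integral => x; rewrite inE => ->.
Qed.

Lemma measure_discrete (A : set T) :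
  mu A = (\sum_(i | e i \in A) mu [set e i])%E.
Proof.
rewrite -[LHS]mul1e -integral_cst //.
rewrite (ge0_integral_discrete (f := fun=> 1)) //.
by under eq_bigr do rewrite mul1e.
Qed.

End FiniteDiscreteMeasure.

Lemma counting_set1 (T : choiceType) (R : realType) (x : T) :
  counting [set x] = 1%E :> \bar R.
Proof. by rewrite /counting asboolT //= fset_set1 cardfs1. Qed.

(** * The identification of G/H with {1, ..., n} *)

Section CosetsOfStabilizer.
Variables (n : nat) (hn : (2 <= n)%N).
Local Notation i0 := (first hn).
Local Notation H := (stabilizer i0).
Local Notation X := (coset_space H).

(** The chosen representative [h] differs from [g] by right multiplication by an element of the
    stabilizer, which does not change the image of the first point. *)
Lemma orbit_point_pi (g : sym n) :
  orbit_point hn (\pi_X g) = sym_perm g i0.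
Proof.
rewrite /orbit_point; set h := repr _.
have : same_coset H h g.
  have /eqmodP : \pi_X h = \pi_X g by rewrite reprK.
  by [].
rewrite /same_coset inE sym_mulE => /eqP hg.
by rewrite -{1}hg; exact: permKV.
Qed.

(** Inverse of [orbit_point]: any permutation sending the first point to [i] represents the coset,
    and a transposition is the simplest. *)
Definition coset_of_outcome (i : 'I_n) : borel_coset_space H :=
  \pi_X (tperm i0 i : sym n).

Lemma coset_of_outcomeK : cancel coset_of_outcome (orbit_point hn).
Proof. by move=> i; rewrite orbit_point_pi; exact: tpermL. Qed.

Lemma orbit_point_inj : injective (orbit_point hn).
Proof.
move=> x y; rewrite /orbit_point => xy.
rewrite -[x]reprK -[y]reprK; apply/eqmodP.
rewrite /= /same_coset inE sym_mulE -xy; apply/eqP; exact: permK.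
Qed.

Lemma orbit_pointK : cancel (orbit_point hn) coset_of_outcome.
Proof. by move=> x; apply: orbit_point_inj; rewrite coset_of_outcomeK. Qed.

Lemma coset_of_outcome_bij : bijective coset_of_outcome.
Proof. exact: Bijective coset_of_outcomeK orbit_pointK. Qed.

(** Equivariance of the identification, which turns relative invariance of a measure on G/H into a
    relation between point masses. *)
Lemma translate_coset_of_outcome (g : sym n) (i : 'I_n) :
  translate g (coset_of_outcome i) = coset_of_outcome (sym_perm g i).
Proof.
apply: orbit_point_inj; rewrite orbit_point_pi sym_mulE coset_of_outcomeK.
by congr (sym_perm g _); exact: coset_of_outcomeK.
Qed.

Lemma coset_space_open (U : set X) : open U.
Proof. exact: (@discrete_open (sym n)). Qed.

Lemma coset_space_measurable (A : set (borel_coset_space H)) : measurable A.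
Proof. by apply: sub_sigma_algebra; exact: coset_space_open. Qed.

Lemma coset_space_finite (A : set X) : finite_set A.
Proof.
apply: (@sub_finite_set _ _ [set: X]) => //.
apply: (@sub_finite_set _ _ (coset_of_outcome @` [set: 'I_n])).
  by move=> x _; exists (orbit_point hn x) => //; exact: orbit_pointK.
exact/finite_image/finite_finset.
Qed.

Lemma coset_space_compact (A : set X) : compact A.
Proof. exact/finite_compact/coset_space_finite. Qed.

End CosetsOfStabilizer.

(** * Relatively invariant Radon measures on G/H *)

Section ReferenceMeasure.
Variables (R : realType) (n : nat) (hn : (2 <= n)%N).
Local Notation X := (borel_coset_space (stabilizer (first hn))).

(** Every subset is both open and compact, so each set realizes its own outer and inner
    approximation. Translations permute the points, so [chi] is constantly 1. *)
Lemma reference_measure_counting :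
  reference_measure (counting : {measure set X -> \bar R}).
Proof.
have countingE (A : set X) : counting A =
    (\sum_(i | coset_of_outcome hn i \in A) 1)%E :> \bar R.
  rewrite (measure_discrete _ (coset_of_outcome_bij hn)
    (@coset_space_measurable n hn)).
  by apply: eq_bigr => i _; rewrite /= counting_set1.
split; first split.
- move=> K _; rewrite /= /counting asboolT ?ltry //.
  exact: (@coset_space_finite n hn).
- move=> A _; apply/esym/le_anti/andP; split.
    apply: ereal_inf_lbound; exists A => //; split=> //.
    exact: coset_space_open.
  apply: le_ereal_inf_tmp => _ [U [_ AU] <-].
  by apply: le_measure => //; rewrite inE; exact: coset_space_measurable.
- move=> U _; apply/le_anti/andP; split.
    apply: ereal_sup_ubound; exists U => //; split=> //.
    exact: coset_space_compact.
  apply: ge_ereal_sup => _ [K [_ KU] <-].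
  by apply: le_measure => //; rewrite inE; exact: coset_space_measurable.
- exists (fun=> 1) => // g A _; rewrite invr1 mul1e /pushforward /=.
  rewrite !countingE [RHS](reindex_inj (@perm_inj _ (sym_perm g))).
  apply: eq_bigl => i.
  by apply/idP/idP; rewrite !inE /= translate_coset_of_outcome.
- have /eqP : counting [set: X] != 0%E :> \bar R; last by [].
  rewrite countingE gt_eqF // (bigD1 (first hn)) ?in_setT //=.
  by apply: (lt_le_trans lte01); rewrite leeDl // sume_ge0.
Qed.

(** Finiteness comes from compactness. If one point had mass 0, transitivity and relative invariance
    would make every point null, against [nu] being nonzero. *)
Lemma reference_measure_set1 (nu : {measure set X -> \bar R}) (i : 'I_n) :
  reference_measure nu ->
  exists2 c : R, 0 < c & nu [set coset_of_outcome hn i] = c%:E.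
Proof.
move=> [[nu_fin _ _] [chi chi0 nu_chi] nuT].
have nu_lty A : (nu A < +oo)%E by apply: nu_fin; exact: coset_space_compact.
have nu_fin_num A : nu A \is a fin_num by rewrite ge0_fin_numE.
exists (fine (nu [set coset_of_outcome hn i])); last by rewrite fineK.
rewrite lt0r fine_ge0 // andbT; apply/eqP => nui.
have {}nui : nu [set coset_of_outcome hn i] = 0%E by rewrite -[LHS]fineK ?nui.
apply: nuT; rewrite (measure_discrete _ (coset_of_outcome_bij hn)
  (@coset_space_measurable n hn)).
apply: big1 => j _.
(* The transposition of [j] and [i] pulls the null point of index [i] back to the point of index
   [j]. *)
have := nu_chi (tperm j i : sym n) _
  (coset_space_measurable [set coset_of_outcome hn i]).
rewrite nui mule0 => <-; congr (nu _); apply/seteqP; split=> [_ ->|x] /=.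
  by rewrite translate_coset_of_outcome /= tpermL.
rewrite -[x](orbit_pointK) translate_coset_of_outcome.
move=> /(bij_inj (coset_of_outcome_bij hn)) xj; congr coset_of_outcome.
by apply: (@perm_inj _ (tperm j i)); rewrite tpermL.
Qed.

End ReferenceMeasure.

(** * The orbit of the base vector in the standard representation *)

Section StandardRepresentation.
Variables (R : realType) (n : nat) (hn : (2 <= n)%N).
Local Notation i0 := (first hn).
Local Notation W := (sum_zero R n).

Lemma base_vectorE :
  base_vector R hn = const_mx 1 - n%:R *: delta_mx 0 i0.
Proof.
apply/rowP => j; rewrite !mxE eqxx /=.
by case: eqP => _; rewrite ?mulr1 ?mulr0 ?subr0 // opprB.
Qed.

Lemma base_vector_sum_zero : base_vector R hn \in W.
Proof.
rewrite mem_sum_zero base_vectorE.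
under eq_bigr do rewrite !mxE eqxx /=.
rewrite big_split /= sumr_const card_ord sumrN -mulr_sumr.
rewrite (bigD1 i0) //= big1 ?addr0 ?mulr1 ?subrr //.
by move=> j /negPf ->.
Qed.

(** The all-ones vector is fixed by G and only the basis vector moves. Neither summand need lie in
    [W], so the computation takes place in the ambient space. *)
Lemma standard_rep_base_vector (g : sym n) :
  vsval (standard_rep R g (vsproj W (base_vector R hn))) =
  const_mx 1 - n%:R *: delta_mx 0 (sym_perm g i0).
Proof.
rewrite standard_repE vsprojK ?base_vector_sum_zero // base_vectorE.
rewrite linearB linearZ /= perm_rep_delta; congr (_ - _).
apply/rowP => j; rewrite lfunE /= -[sym_perm g]invgK -col_permE.
by rewrite !mxE.
Qed.

Lemma sym_continuous (T : topologicalType) (f : sym n -> T) : continuous f.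
Proof.
move=> g A /nbhs_singleton Ag.
by apply: (@filterS _ (nbhs g) _ [set g]); [move=> _ ->|exact: discrete_set1].
Qed.

Lemma standard_rep_admissible :
  admissible (stabilizer i0) (@standard_rep R n) (vsproj W (base_vector R hn)).
Proof.
split; first exact: (@discrete_closed (sym n)); first split.
- apply/lfunP => w; apply: subvs_inj; rewrite standard_repE !lfunE /=.
  by rewrite [sym_perm _](_ : _ = 1%g) // perm_mx1 mulmx1.
- move=> g h; apply/lfunP => w; apply: subvs_inj.
  (* Matrices act on row vectors from the right, which reverses the order of products; the reversed
     product of [sym n] compensates. *)
  rewrite comp_lfunE !standard_repE !lfunE /= -mulmxA -perm_mxM.
  by [].
- exact: sym_continuous.
- move=> h; rewrite inE => /eqP hi0; apply: subvs_inj.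
  rewrite standard_rep_base_vector hi0 -base_vectorE vsprojK //.
  exact: base_vector_sum_zero.
Qed.

End StandardRepresentation.

(** * Full support and the categorical distributions *)

Section CategoricalFamily.
Variables (R : realType) (n : nat) (hn : (2 <= n)%N).
Local Notation i0 := (first hn).
Local Notation X := (borel_coset_space (stabilizer i0)).
Local Notation W := (sum_zero R n).
Local Notation v0 := (vsproj W (base_vector R hn)).
Local Notation e := (coset_of_outcome hn).

Lemma outcomes_measure (mu : {measure set (outcomes hn) -> \bar R})
    (A : set (outcomes hn)) :
  mu A = (\sum_(i : 'I_n | (i : outcomes hn) \in A)
            mu [set (i : outcomes hn)])%E.
Proof.
by apply: (@measure_discrete _ _ _ 'I_n (id : 'I_n -> outcomes hn));
  first exists id.
Qed.

(** The product density at [x] reduces to [s x], so the parameters are the point masses of [P],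
    whose sum is 1 automatically. *)
Lemma categoricalP (P : probability (outcomes hn) R) :
  categorical R hn P <-> forall i : outcomes hn, (0 < P [set i])%E.
Proof.
have counting_int (s : 'I_n -> R) A : (forall i, 0 < s i) ->
    (\int[@counting (outcomes hn) R]_(x in A)
       (\prod_(i < n) s i ^+ (i == x))%:E =
     \sum_(i : 'I_n | (i : outcomes hn) \in A) (s i)%:E)%E.
  move=> s0; rewrite (@ge0_integral_discrete _ _ _ 'I_n
    (id : 'I_n -> outcomes hn)) //; [|by exists id|].
    apply: eq_bigr => i _; rewrite /= counting_set1 mule1.
    rewrite (bigD1 i) //= eqxx expr1 big1 ?mulr1 // => j /negPf.
    by move=> ->; rewrite expr0.
  by move=> x; apply: prodr_ge0 => i _; rewrite exprn_ge0 // ltW.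
split=> [[s [s0 _ PE]] i|P0].
  rewrite PE // counting_int // (big_pred1 i) ?lte_fin // => j.
  by apply/idP/eqP; rewrite inE.
exists (fun i => fine (P [set (i : outcomes hn)])).
have Pfin (A : set (outcomes hn)) : P A \is a fin_num.
  exact: fin_num_measure.
have s0 (i : outcomes hn) : 0 < fine (P [set i]).
  by rewrite -lte_fin fineK.
split=> // [|A mA].
  apply: EFin_inj; rewrite -sumEFin -(probability_setT P) [RHS]outcomes_measure.
  by apply: eq_big => [i|i _]; rewrite ?in_setT ?fineK.
rewrite counting_int // outcomes_measure.
by apply: eq_bigr => i _; rewrite fineK.
Qed.

(* On the orbit vector [(1, ..., 1) - n e_i] the functional with coordinates
   [b j / n] takes the value [\sum_j b j / n - b i]. *)
Lemma orbit_interpolation (b : 'I_n -> R) :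
  exists (phi : 'Hom(subvs_of W, R^o)) (k : R), forall g : sym n,
    phi (standard_rep R g v0) = k - b (sym_perm g i0).
Proof.
pose f (w : subvs_of W) : R^o := \sum_(j < n) (b j / n%:R) * vsval w 0 j.
have f_linear : linear f.
  move=> a u v; rewrite /f scaler_sumr -big_split; apply: eq_bigr => j _ /=.
  by rewrite !mxE mulrDr mulrCA.
pose F : {linear subvs_of W -> R^o} :=
  HB.pack f (GRing.isLinear.Build _ _ _ _ f f_linear).
exists (linfun F), (\sum_(j < n) b j / n%:R) => g.
rewrite lfunE /= /f standard_rep_base_vector.
(* Writing [b] at the moved point as a sum over [j] allows a termwise comparison; the factor [n]
   cancels the denominators. *)
rewrite -[b _](_ :
    \sum_(j < n) b j / n%:R * (n%:R * (j == sym_perm g i0)%:R) = _).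
  by rewrite -sumrB; apply: eq_bigr => j _; rewrite !mxE eqxx mulrBr mulr1.
rewrite (bigD1 (sym_perm g i0)) //= eqxx big1 ?addr0.
  by rewrite mulr1 divfK // pnatr_eq0 -lt0n (ltn_trans _ hn).
by move=> j /negPf ->; rewrite !mulr0.
Qed.

(** * The exponential family of a given reference measure *)

Section FixedReferenceMeasure.
Variable nu : {measure set X -> \bar R}.
Hypothesis nu_ref : reference_measure nu.
Local Notation rho := (@standard_rep R n).

Lemma tilde_p_sum (theta : param (sym n) (subvs_of W)) (A : set X) :
  (tilde_p rho v0 nu theta A =
   \sum_(i | e i \in A) (density rho v0 theta (e i))%:E * nu [set e i])%E.
Proof.
apply: ge0_integral_discrete.
- exact: coset_of_outcome_bij.
- exact: coset_space_measurable.
- by move=> x; exact: expR_ge0.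
Qed.

Lemma exp_family_gt0 (P : probability X R) (i : 'I_n) :
  exp_family rho v0 nu P -> (0 < P [set e i])%E.
Proof.
move=> [theta [_ Zfin] PE]; rewrite PE; last exact: coset_space_measurable.
have mass_gt0 j : (0 < (density rho v0 theta (e j))%:E * nu [set e j])%E.
  have [c c0 ->] := reference_measure_set1 j nu_ref.
  by rewrite -EFinM lte_fin mulr_gt0 // expR_gt0.
apply: mule_gt0; last first.
  rewrite tilde_p_sum (big_pred1 i) // => j.
  apply/idP/eqP; rewrite inE; last by move->.
  by move=> /(bij_inj (coset_of_outcome_bij hn)).
(* Integrability is essential here: [fine] sends an infinite normalizing constant to 0. *)
rewrite lte_fin invr_gt0 fine_gt0 // Zfin andbT tilde_p_sum.
rewrite (bigD1 i) ?in_setT //=; apply: (lt_le_trans (mass_gt0 i)).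
by rewrite leeDl // sume_ge0 // => j _; exact: ltW.
Qed.

(** Interpolating the logarithms of the ratios [s i / c i] of the masses under [Q] and [nu] makes
    the density [expR (- k) * (s i / c i)]; multiplying by [c i] leaves [s i] up to the common
    factor [K = expR (- k)]. *)
Lemma tilde_p_proportional (Q : probability (outcomes hn) R) :
  (forall i : outcomes hn, 0 < Q [set i])%E ->
  exists2 theta, W0 (stabilizer i0) theta.2 &
    exists2 K : R, 0 < K & forall A,
      tilde_p rho v0 nu theta A = (K%:E * Q (e @^-1` A))%E.
Proof.
move=> Q0; have Qfin (A : set (outcomes hn)) : Q A \is a fin_num.
  exact: fin_num_measure.
pose c i := fine (nu [set e i]).
have cE i : nu [set e i] = (c i)%:E /\ 0 < c i.
  by have [x x0 nux] := reference_measure_set1 i nu_ref; rewrite /c nux.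
pose s (i : outcomes hn) := fine (Q [set i]).
have s0 i : 0 < s i by rewrite -lte_fin fineK.
have [phi [k phiE]] := orbit_interpolation (fun i => ln (s i / c i)).
exists (phi, fun=> 0).
  split=> //= [|g h]; first exact: sym_continuous.
  by rewrite addr0.
exists (expR (- k)) => [|A]; first exact: expR_gt0.
rewrite tilde_p_sum outcomes_measure ge0_sume_distrr //.
apply: eq_big => [i|i _]; first by apply/idP/idP; rewrite !inE.
have [-> c0] := cE i.
transitivity ((expR (- k))%:E * (s i)%:E)%E; last by rewrite fineK.
rewrite -!EFinM; congr _%:E.
rewrite /density /= phiE -/(orbit_point hn (e i)) coset_of_outcomeK.
rewrite addr0 opprB addrC expRD lnK ?posrE ?divr_gt0 //.
by rewrite -mulrA divfK // gt_eqF.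
Qed.

Lemma transported_exp_family :
  transported_family (orbit_point hn) (exp_family rho v0 nu) =
  categorical R hn.
Proof.
apply/seteqP; split=> Q.
  move=> [P famP QE]; apply/categoricalP => i; rewrite QE // /pushforward.
  rewrite [X in P X](_ : _ = [set e i]); first exact: exp_family_gt0.
  apply/seteqP; split=> x /= => [<-|->]; first by rewrite orbit_pointK.
  exact: coset_of_outcomeK.
move=> /categoricalP/tilde_p_proportional[theta theta_W0 [K K0 pE]].
have e_mfun : measurable_fun [set: outcomes hn] (e : _ -> X) by [].
pose E : {mfun outcomes hn >-> X} := HB.pack (e : outcomes hn -> X)
  (isMeasurableFun.Build _ _ _ _ (e : outcomes hn -> X) e_mfun).
(* The preimage of [Q] in the family is its image under the inverse bijection. The total mass of
   [tilde_p] is [K], so the parameter is admissible and normalization removes [K]. *)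
exists (distribution Q E) => [|A _].
  have ZE : tilde_p rho v0 nu theta [set: X] = K%:E.
    by rewrite pE preimage_setT probability_setT mule1.
  exists theta; first by split=> //; rewrite ZE ltry.
  move=> A _; rewrite ZE pE muleA -EFinM mulVf ?gt_eqF // mul1e.
  by [].
rewrite /pushforward /distribution /pushforward /=; congr (Q _).
by apply/seteqP; split=> i /=; rewrite coset_of_outcomeK.
Qed.

End FixedReferenceMeasure.
End CategoricalFamily.

(** The existence clause keeps the last one, which ranges over all reference measures, from being
    vacuous. *)
Theorem proposition4p6 (R : realType) (n : nat) (hn : (2 <= n)%N) :
  let H : groupClosed (sym n) := stabilizer (first hn) in
  let X := borel_coset_space H in
  let W := sum_zero R n in
  let rho := @standard_rep R n in
  let v0 := vsproj W (base_vector R hn) in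
  [/\ base_vector R hn \in W /\ admissible H rho v0,
      (forall g : sym n,
         orbit_point hn (\pi_(coset_space H) g) = sym_perm g (first hn)) /\
      bijective (orbit_point hn),
      exists nu : {measure set X -> \bar R}, reference_measure nu &
      forall nu : {measure set X -> \bar R}, reference_measure nu ->
        transported_family (orbit_point hn) (exp_family rho v0 nu) =
        categorical R hn].
Proof.
move=> H X W rho v0; split.
- by split; [exact: base_vector_sum_zero|exact: standard_rep_admissible].
- split; first exact: orbit_point_pi.
  exact: Bijective (@orbit_pointK n hn) (@coset_of_outcomeK n hn).
- by exists counting; exact: reference_measure_counting.
- exact: transported_exp_family.
Qed.
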